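(* Let $\mathcal{H}_1,\dots,\mathcal{H}_n$ be independent invariant functionals of the conservative PDE $\frac{\partial u}{\partial t}=\mathcal{J}\frac{\delta\mathcal{G}}{\delta u}$, $u(t_0)=u_0$, let $\frac{\delta\mathcal{H}_i}{\delta(\cdot,\cdot)}$ be a fixed discrete variational derivative of $\mathcal{H}_i$ for each $i$, and let $\psi_h$ be an arbitrary one-step time-stepping integrator of order $p$ for the PDE. Let $\mathcal{P}(v,w)$ be the projection operator defined in the context. Then the projection integrator $$u^{k+1}(x)=u^k(x)+\mathcal{P}\left(u^{k+1}(x),u^k(x)\right)\left(\psi_h(u^k(x))-u^k(x)\right),\qquad k=0,1,2,\dots,$$ preserves the $n$ invariants: $\mathcal{H}_i[u^{k+1}]=\mathcal{H}_i[u^k]$ for all $i=1,\dots,n$ and $k=0,1,2,\dots$.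
   Context: Setting. $\Omega\subseteq\mathbb{R}^d$, and $\mathcal{F}(\Omega)\subset L^2(\Omega)$ is the (linear) function space in which the solutions $u(\cdot,t)$ lie; numerical solutions $u^k$ lie in $\mathcal{F}(\Omega)$, and $\psi_h$ maps $\mathcal{F}(\Omega)$ to itself. $\langle v,w\rangle=\int_\Omega vw\,dx$ is the $L^2(\Omega)$ inner product. The PDE is $\frac{\partial u}{\partial t}=\mathcal{J}\frac{\delta\mathcal{G}}{\delta u}$, $u(t_0)=u_0$, where $\mathcal{J}$ is a skew-adjoint operator and $\mathcal{G}[u]=\int_\Omega G[u]\,dx$, with $G[u]$ depending on $u$ and its $x$-derivatives up to some finite degree. The variational derivative of a functional $\mathcal{G}$ is defined by $\int_\Omega\frac{\delta\mathcal{G}}{\delta u}v\,dx=\frac{d}{d\epsilon}\big|_{\epsilon=0}\mathcal{G}[u+\epsilon v]$ for all sufficiently smooth $v$. Standing assumptions: the solution has sufficient regularity, and the boundary conditions are such that boundary terms vanish in integration by parts. Invariants. $\mathcal{H}_i[u]=\int_\Omega H_i[u]\,dx$, $i=1,\dots,n$, are independent functionals with $\mathcal{H}_i[u(\cdot,t)]$ constant in $t$ along solutions of the PDE. Discrete variational derivative. A discrete variational derivative of a functional $\mathcal{H}$ assigns to any $u,v\in\mathcal{F}(\Omega)$ a function $\frac{\delta\mathcal{H}}{\delta(u,v)}\in\mathcal{F}(\Omega)$ such that $\mathcal{H}[u]-\mathcal{H}[v]=\left\langle\frac{\delta\mathcal{H}}{\delta(u,v)},u-v\right\rangle$ for $u\neq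 v$, and $\frac{\delta\mathcal{H}}{\delta(u,u)}=\frac{\delta\mathcal{H}}{\delta u}$. Projection operator. For $v,w\in\mathcal{F}(\Omega)$ let $Y(v,w)=\mathrm{span}\left\{\frac{\delta\mathcal{H}_1}{\delta(v,w)},\dots,\frac{\delta\mathcal{H}_n}{\delta(v,w)}\right\}$ and let $\{w^1(x),\dots,w^n(x)\}$ be an orthonormal basis of $Y(v,w)$ with respect to $\langle\cdot,\cdot\rangle$ (such a basis of $n$ elements is assumed to exist). Then $\mathcal{P}(v,w)z=z-\sum_{i=1}^n\langle z,w^i\rangle w^i$. The scheme is implicit in $u^{k+1}$; the statement concerns any sequence $(u^k)$ in $\mathcal{F}(\Omega)$ satisfying the recursion. Order $p$ means $\|u(x,t+h)-\psi_h(u(x,t))\|=\mathcal{O}(h^{p+1})$ in $L^2(\Omega)$ for the exact solution $u$. *)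

(* Defs.v *)
From HB Require Import structures.
From mathcomp Require Import all_boot all_order all_algebra.
From mathcomp Require Import all_classical all_reals all_analysis.
Set Implicit Arguments.
Unset Strict Implicit.
Unset Printing Implicit Defensive.
Import Order.TTheory GRing.Theory Num.Theory.
Import numFieldNormedType.Exports.
Local Open Scope classical_set_scope.
Local Open Scope ring_scope.

Section RowVectorMeasurable.
Context {dsp : measure_display} {T : measurableType dsp}.
Variable n : nat.

Let coors : 'I_n -> 'rV[T]_n -> T := fun i x => x ord0 i.

Let rV_set0 : g_sigma_preimage coors set0.
Proof. exact: sigma_algebra0. Qed.

Let rV_setC A : g_sigma_preimage coors A -> g_sigma_preimage coors (~` A).
Proof. exact: sigma_algebraC. Qed.

Let rV_bigcup (A : (set 'rV[T]_n)^nat) :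
  (forall i, g_sigma_preimage coors (A i)) ->
  g_sigma_preimage coors (\bigcup_i (A i)).
Proof. exact: sigma_algebra_bigcup. Qed.

(* The product sigma-algebra on row vectors; for T = R it is the Borel one. *)
HB.instance Definition _ := @isMeasurable.Build (measure_tuple_display dsp)
  'rV[T]_n (g_sigma_preimage coors) rV_set0 rV_setC rV_bigcup.

Lemma measurable_rV_coord (i : 'I_n) :
  measurable_fun [set: 'rV[T]_n] (fun x : 'rV[T]_n => x ord0 i).
Proof.
move=> _ Y mY; rewrite setTI; apply: sub_sigma_algebra => /=.
rewrite -bigcup_seq/=; exists i => /=; first by rewrite mem_index_enum.
by exists Y => //; rewrite setTI.
Qed.

Lemma measurable_fun_rV (dsp' : measure_display) (S : measurableType dsp')
    (f : S -> 'rV[T]_n) :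
  (forall i, measurable_fun [set: S] (fun x => f x ord0 i)) ->
  measurable_fun [set: S] f.
Proof.
move=> mf _ A mA.
have : preimage_set_system [set: S] f (g_sigma_preimage coors)
    ([set: S] `&` f @^-1` A).
  by exists A.
rewrite -g_sigma_preimage_comp; apply: smallest_sub.
  exact: sigma_algebra_measurable.
rewrite -bigcup_seq; apply: bigcup_sub => i _ B [C mC <-].
exact: mf.
Qed.

End RowVectorMeasurable.

Section LebesgueStep.
Variables (R : realType) (d : nat).

Definition cons_rV (p : R * 'rV[R]_d) : 'rV[R]_d.+1 :=
  \row_j if unlift ord0 j is Some k then p.2 ord0 k else p.1.

Lemma measurable_cons_rV : measurable_fun setT cons_rV.
Proof.
apply: measurable_fun_rV => i; rewrite /cons_rV.
case: (unliftP ord0 i) => [k|] ->.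
- apply: (eq_measurable_fun (fun p : R * 'rV[R]_d => p.2 ord0 k)).
    by move=> p _ /=; rewrite mxE liftK.
  by apply: (measurableT_comp (measurable_rV_coord k)).
- apply: (eq_measurable_fun (fun p : R * 'rV[R]_d => p.1)).
    by move=> p _ /=; rewrite mxE unlift_none.
  exact: measurable_fst.
Qed.

Definition uncons_rV (x : 'rV[R]_d.+1) : R * 'rV[R]_d :=
  (x ord0 ord0, \row_k x ord0 (lift ord0 k)).

Lemma uncons_rVK : cancel uncons_rV cons_rV.
Proof.
move=> x; apply/rowP => j; rewrite mxE.
by case: (unliftP ord0 j) => [k|] -> //=; rewrite mxE.
Qed.

Lemma cons_rVK : cancel cons_rV uncons_rV.
Proof.
case=> a v; rewrite /uncons_rV mxE unlift_none; congr pair.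
by apply/rowP => j; rewrite !mxE liftK.
Qed.

Lemma measurable_uncons_rV : measurable_fun setT uncons_rV.
Proof.
apply: measurable_fun_pair; first exact: measurable_rV_coord.
apply: measurable_fun_rV => k.
apply: (eq_measurable_fun (fun x : 'rV[R]_d.+1 => x ord0 (lift ord0 k))).
  by move=> x _; rewrite mxE.
exact: measurable_rV_coord.
Qed.

Variable mu : {sigma_finite_measure set 'rV[R]_d -> \bar R}.

Definition lebesgue_step : set 'rV[R]_d.+1 -> \bar R :=
  pushforward (@lebesgue_measure R \x mu)%E cons_rV.

Let mcons : measurable_fun [set: measurableTypeR R * 'rV[R]_d] cons_rV :=
  measurable_cons_rV.

Let step0 : lebesgue_step set0 = 0%E.
Proof. exact: measure0. Qed.

Let step_ge0 A : (0 <= lebesgue_step A)%E.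
Proof. exact: measure_ge0. Qed.

Let step_sigma_additive : semi_sigma_additive lebesgue_step.
Proof.
exact: (@measure_semi_sigma_additive _ _ _
  (@pushforward _ _ _ _ _ (@lebesgue_measure R \x mu)%E cons_rV)).
Qed.

HB.instance Definition _ := isMeasure.Build _ _ _ lebesgue_step
  step0 step_ge0 step_sigma_additive.

Let step_sigma_finite : sigma_finite setT lebesgue_step.
Proof.
have /sigma_finiteP[A [TA ndA Aoo]] := sigma_finiteT (@lebesgue_measure R).
have /sigma_finiteP[B [TB ndB Boo]] := sigma_finiteT mu.
exists (fun k => uncons_rV @^-1` (A k `*` B k)).
  rewrite -preimage_bigcup; apply/esym; rewrite -subTset => x _ /=.
  have [k _ Ak] : (\bigcup_k A k) (uncons_rV x).1 by rewrite -TA.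
  have [l _ Bl] : (\bigcup_k B k) (uncons_rV x).2 by rewrite -TB.
  exists (maxn k l) => //; split.
    by move: Ak; exact/subsetPset/ndA/leq_maxl.
  by move: Bl; exact/subsetPset/ndB/leq_maxr.
move=> k; have [mA Ak] := Aoo k; have [mB Bk] := Boo k; split.
  rewrite -[X in measurable X]setTI; apply: measurable_uncons_rV => //.
  exact: measurableX.
rewrite /lebesgue_step /pushforward -comp_preimage.
rewrite (_ : _ \o _ = id); last by apply/funext => p; exact: cons_rVK.
by rewrite preimage_id product_measure1E// lte_mul_pinfty// ge0_fin_numE.
Qed.

HB.instance Definition _ := Measure_isSigmaFinite.Build _ _ _ lebesgue_step
  step_sigma_finite.

End LebesgueStep.

(* d-dimensional Lebesgue measure, as an iterated product. *)
Fixpoint lebesgue_rV (R : realType) (d : nat) :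
    {sigma_finite_measure set 'rV[R]_d -> \bar R} :=
  match d with
  | 0 => \d_(0 : 'rV[R]_0)
  | d'.+1 => lebesgue_step (lebesgue_rV R d')
  end.

Lemma lebesgue_rV_box (R : realType) (d : nat) (A : 'I_d -> set R) :
  (forall i, measurable (A i)) ->
  lebesgue_rV R d [set x | forall i, A i (x ord0 i)] =
  (\prod_(i < d) lebesgue_measure (A i))%E.
Proof.
elim: d A => [|d ih] A mA /=.
  by rewrite big_ord0 diracE mem_set// => -[].
have mS : measurable [set x : 'rV[R]_d | forall i, A (lift ord0 i) (x ord0 i)].
  rewrite (_ : mkset _ = \bigcap_(i in [set: 'I_d])
      ((fun x : 'rV[R]_d => x ord0 i) @^-1` A (lift ord0 i))).
    apply: fin_bigcap_measurable => // i _.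
    by rewrite -[X in measurable X]setTI; exact: measurable_rV_coord.
  by apply/seteqP; split => x /= h i => [_|]; exact: h.
rewrite big_ord_recl -ih//.
rewrite /lebesgue_step /pushforward -product_measure1E//; last exact: mA.
congr (_ _); apply/seteqP; split => -[a v] /=.
- move=> h; split=> [|i] /=; first by have := h ord0; rewrite mxE unlift_none.
  by have := h (lift ord0 i); rewrite mxE liftK.
- by case=> ha hv i; rewrite mxE; case: (unliftP ord0 i) => [k|] -> //=.
Qed.

Section FunctionsOnDomain.
Variables (R : realType) (d : nat) (Omega : set 'rV[R]_d).

Notation mu := (lebesgue_rV R d).
Notation E := ('rV[R]_d -> R).

(* Functions on Omega are represented by their extension by zero, so that
   equality of functions on Omega is Leibniz equality. *)
Definition L2 : set E :=
  [set f | f \in Lfun mu 2%:E /\ forall x, ~ Omega x -> f x = 0].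

Definition inner (v w : E) : R := \int[mu]_(x in Omega) (v x * w x).

Definition L2norm (v : E) : R := Num.sqrt (inner v v).

(* Partial derivatives only use values on Omega: the increments are restricted
   to those that stay in Omega.  On an open Omega this is 'D_('e_i). *)
Definition partial_quot (i : 'I_d) (f : E) (x : 'rV[R]_d) : set_system R :=
  (fun h : R => h^-1 * (f (x + h *: 'e_i) - f x))
    @ within [set h | Omega (x + h *: 'e_i)] 0^'.

Definition partial (i : 'I_d) (f : E) : E := fun x => lim (partial_quot i f x).

Definition partials (s : seq 'I_d) (f : E) : E := foldr partial f s.

Definition smooth (r : nat) (f : E) : Prop :=
  (forall s, (size s <= r)%N -> {within Omega, continuous (partials s f)}) /\
  (forall s i x, (size s < r)%N -> Omega x ->
    cvg (partial_quot i (partials s f) x)).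

(* A jet lists the values at a point of all the partial derivatives of a
   function; the functional with density g integrates g over the jets of u. *)
Definition jet := seq 'I_d -> R.

Definition order_at_most (m : nat) (g : jet -> R) : Prop :=
  forall j j' : jet, (forall s, (size s <= m)%N -> j s = j' s) -> g j = g j'.

Definition density (g : jet -> R) (u : E) : E :=
  fun x => g (fun s => partials s u x).

Definition functional (g : jet -> R) (u : E) : R :=
  \int[mu]_(x in Omega) density g u x.

Section FunctionSpace.
Variable F : set E.

Definition function_space : Prop :=
  [/\ F `<=` L2, F 0 &
    forall (a : R) u v, F u -> F v -> F (a *: u + v)].

Definition functional_density (m : nat) (g : jet -> R) : Prop :=
  order_at_most m g /\
  forall u, F u -> mu.-integrable Omega (EFin \o density g u).

(* The test functions stay in the linear space F, on which H is defined, and r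
   is the smoothness that "sufficiently smooth" asks for. *)
Definition is_variational_derivative (H : E -> R) (u g : E) : Prop :=
  L2 g /\ exists r : nat, forall v, F v -> smooth r v ->
    is_derive (0 : R) 1 (fun e : R => H (u + e *: v)) (inner g v).

Definition is_discrete_variational_derivative (H : E -> R)
    (dH : E -> E -> E) : Prop :=
  [/\ forall u v, F u -> F v -> F (dH u v),
      forall u v, F u -> F v -> u <> v -> H u - H v = inner (dH u v) (u - v) &
      forall u, F u -> is_variational_derivative H u (dH u u)].

(* Functional independence: no H j is a function of the other ones. *)
Definition functionally_independent (n : nat) (H : 'I_n -> E -> R) : Prop :=
  forall j, ~ exists phi : ('I_n -> R) -> R,
    forall u, F u -> H j u = phi (fun i => if i == j then 0 else H i u).

(* J is a possibly unbounded operator with domain D.  This is skew-adjointness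
   with respect to the inner product in the formal sense, where boundary terms
   vanish; nothing is required of the domain of the adjoint. *)
Definition skew_adjoint (D : set E) (J : E -> E) : Prop :=
  [/\ D `<=` L2,
      D 0 /\ (forall (a : R) v w, D v -> D w -> D (a *: v + w)),
      forall v, D v -> L2 (J v),
      forall (a : R) v w, D v -> D w -> J (a *: v + w) = a *: J v + J w &
      forall v w, D v -> D w -> inner (J v) w = - inner v (J w)].

(* Classical solutions on [t0, T] of u_t = J (dG/du), u(t0) = u0; the time
   derivative is one-sided at t0 and at T. *)
Definition pde_solution (m : nat) (G : E -> R) (D : set E) (J : E -> E)
    (t0 T : R) (u0 : E) (u : R -> E) : Prop :=
  [/\ t0 < T, u t0 = u0 &
    forall t, t0 <= t <= T ->
      [/\ F (u t), smooth m (u t) &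
        exists g, [/\ is_variational_derivative G (u t) g, D g &
          forall x, Omega x ->
            (fun h : R => h^-1 * (u (t + h) x - u t x))
              @ within [set h | t0 <= t + h <= T] 0^' --> J g x]]].

Definition is_invariant (m : nat) (G : E -> R) (D : set E) (J : E -> E)
    (H : E -> R) : Prop :=
  forall t0 T u0 u, pde_solution m G D J t0 T u0 u ->
    forall t, t0 <= t <= T -> H (u t) = H u0.

Definition integrator_of_order (p m : nat) (G : E -> R) (D : set E) (J : E -> E)
    (psi : R -> E -> E) : Prop :=
  (forall h u, 0 < h -> F u -> F (psi h u)) /\
  forall t0 T u0 u, pde_solution m G D J t0 T u0 u ->
    forall t, t0 <= t < T ->
      (fun h : R => L2norm (u (t + h) - psi h (u t)))
        =O_ ((0 : R)^'+) (fun h : R => h ^+ p.+1).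

End FunctionSpace.

Definition lin_span (n : nat) (f : 'I_n -> E) : set E :=
  [set y | exists c : 'I_n -> R, y = \sum_(i < n) c i *: f i].

Definition orthonormal_basis (n : nat) (Y : set E) (w : 'I_n -> E) : Prop :=
  lin_span w = Y /\ forall i j, inner (w i) (w j) = (i == j)%:R.

Definition projector (n : nat) (w : 'I_n -> E) (z : E) : E :=
  z - \sum_(i < n) inner z (w i) *: w i.

End FunctionsOnDomain.

(* Main.v *)
Require Import Defs.
From mathcomp Require Import all_boot all_order all_algebra.
From mathcomp Require Import all_classical all_reals all_analysis.
Set Implicit Arguments.
Unset Strict Implicit.
Unset Printing Implicit Defensive.
Import Order.TTheory GRing.Theory Num.Theory.
Import numFieldNormedType.Exports.
Local Open Scope classical_set_scope.
Local Open Scope ring_scope.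

(** The increment [u k.+1 - u k] is the image of [psi h (u k) - u k] under the
    projector onto the orthogonal complement of the span of the discrete
    variational derivatives at [(u k.+1, u k)] ([inner_lin_span_projector]).
    Hence it is orthogonal to each of them, and the mean-value identity that
    defines a discrete variational derivative turns this orthogonality into
    the vanishing of the increment of each invariant.  If [u k.+1 = u k], where
    that identity says nothing, the conclusion is immediate.

    The analytic input is that [inner] is bilinear on a space of
    square-integrable functions ([inner_linear_l]): since the Lebesgue integral
    of a non-integrable function need not be additive, this rests on the
    integrability of products of two such functions, that is, Hoelder's
    inequality. *)

Section InnerProduct.
Variables (R : realType) (d : nat) (Omega : set 'rV[R]_d).
Hypothesis mOmega : measurable Omega.
Notation E := ('rV[R]_d -> R).
Implicit Types u v w z : E.

Lemma innerC v w : inner Omega v w = inner Omega w v.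
Proof. by apply: eq_Rintegral => x _; rewrite mulrC. Qed.

Lemma integrable_mul_L2 v w : L2 Omega v -> L2 Omega w ->
  (lebesgue_rV R d).-integrable Omega (EFin \o (v \* w)).
Proof.
move=> [v2 _] [w2 _]; apply: (@integrableS _ _ _ _ setT) => //.
exact/Lfun1_integrable/Lfun2_mul_Lfun1.
Qed.

Lemma inner_linear_l a u v w : L2 Omega u -> L2 Omega v -> L2 Omega w ->
  inner Omega (a *: u + v) w = a * inner Omega u w + inner Omega v w.
Proof.
move=> u2 v2 w2; rewrite /inner.
have iuw := integrable_mul_L2 u2 w2; have ivw := integrable_mul_L2 v2 w2.
have iauw : (lebesgue_rV R d).-integrable Omega
    (EFin \o (fun x => a * (u x * w x))).
  exact: (integrableZl mOmega a iuw).
rewrite -RintegralZl// -RintegralD//; apply: eq_Rintegral => x _.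
by rewrite mulrA -mulrDl.
Qed.

Variable F : set E.
Hypothesis spF : function_space Omega F.

Let F_L2 v : F v -> L2 Omega v. Proof. by case: spF => + _ _; exact. Qed.

Let F0 : F 0. Proof. by case: spF. Qed.

Let F_lin a u v : F u -> F v -> F (a *: u + v).
Proof. by case: spF => _ _; exact. Qed.

Let F_sum n (c : 'I_n -> R) (f : 'I_n -> E) (r : seq 'I_n) :
  (forall i, F (f i)) -> F (\sum_(i <- r) c i *: f i).
Proof.
move=> Ff; elim: r => [|i r ih]; first by rewrite big_nil.
by rewrite big_cons; exact: F_lin.
Qed.

Lemma lin_span_sub n (f : 'I_n -> E) :
  (forall i, F (f i)) -> lin_span f `<=` F.
Proof. by move=> Ff _ [c ->]; exact: F_sum. Qed.

Lemma function_spaceB u v : F u -> F v -> F (u - v).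
Proof. by move=> Fu Fv; rewrite addrC -scaleN1r; exact: F_lin. Qed.

Lemma inner_suml n (c : 'I_n -> R) (f : 'I_n -> E) w :
  (forall i, F (f i)) -> F w ->
  inner Omega (\sum_(i < n) c i *: f i) w =
  \sum_(i < n) c i * inner Omega (f i) w.
Proof.
move=> Ff Fw; elim: (index_enum _) => [|i r ih].
  rewrite !big_nil /inner; under eq_Rintegral do rewrite mul0r.
  by rewrite Rintegral_cst// mul0r.
by rewrite !big_cons inner_linear_l ?ih//; apply: F_L2 => //; exact: F_sum.
Qed.

(** By bilinearity, orthonormality reduces the inner product of a basis vector
    [w j] with the projection of [z] to [inner z (w j) - inner z (w j)]. *)
Lemma inner_lin_span_projector n (w : 'I_n -> E) y z :
  (forall i, F (w i)) ->
  (forall i j, inner Omega (w i) (w j) = (i == j)%:R) ->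
  F z -> lin_span w y -> inner Omega y (projector Omega w z) = 0.
Proof.
move=> Fw ow Fz [c ->].
have FP : F (projector Omega w z).
  by apply: function_spaceB => //; exact: F_sum.
rewrite inner_suml// big1// => j _; rewrite innerC.
rewrite [projector _ _ _]addrC -scaleN1r inner_linear_l; last 3 first.
- exact/F_L2/F_sum.
- exact: F_L2.
- exact: F_L2.
rewrite inner_suml// (bigD1 j)//= ow eqxx mulr1 big1 ?addr0.
  by rewrite mulN1r addNr mulr0.
by move=> i ij; rewrite ow (negbTE ij) mulr0.
Qed.

End InnerProduct.

Lemma mem_lin_span (R : realType) (d n : nat) (f : 'I_n -> 'rV[R]_d -> R)
  (i : 'I_n) : lin_span f (f i).
Proof.
exists (fun j => (j == i)%:R); rewrite (bigD1 i)//= eqxx scale1r big1 ?addr0//.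
by move=> j ji; rewrite (negbTE ji) scale0r.
Qed.

Theorem mainTheorem2 (R : realType) (d : nat) (Omega : set 'rV[R]_d)
    (F : set ('rV[R]_d -> R)) (m : nat)
    (D : set ('rV[R]_d -> R)) (J : ('rV[R]_d -> R) -> ('rV[R]_d -> R))
    (G : jet R d -> R) (n : nat) (H : 'I_n -> jet R d -> R)
    (dH : 'I_n -> ('rV[R]_d -> R) -> ('rV[R]_d -> R) -> ('rV[R]_d -> R))
    (p : nat) (psi : R -> ('rV[R]_d -> R) -> ('rV[R]_d -> R))
    (W : ('rV[R]_d -> R) -> ('rV[R]_d -> R) -> 'I_n -> ('rV[R]_d -> R))
    (h : R) (u : nat -> 'rV[R]_d -> R) :
  measurable Omega ->
  function_space Omega F ->
  skew_adjoint Omega D J ->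
  functional_density Omega F m G ->
  (forall i, functional_density Omega F m (H i)) ->
  functionally_independent F (fun i => functional Omega (H i)) ->
  (forall i, is_invariant Omega F m (functional Omega G) D J
    (functional Omega (H i))) ->
  (forall i, is_discrete_variational_derivative Omega F
    (functional Omega (H i)) (dH i)) ->
  integrator_of_order Omega F p m (functional Omega G) D J psi ->
  0 < h ->
  (forall k, F (u k)) ->
  (forall k, orthonormal_basis Omega (lin_span (fun i => dH i (u k.+1) (u k)))
    (W (u k.+1) (u k))) ->
  (forall k, u k.+1 = u k
    + projector Omega (W (u k.+1) (u k)) (psi h (u k) - u k)) ->
  forall i k, functional Omega (H i) (u k.+1) = functional Omega (H i) (u k).
Proof.
move=> mOmega spF _ _ _ _ _ dvd [Fpsi _] h0 Fu onW uS i k.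
have [->//|/eqP neq] := eqVneq (u k.+1) (u k).
have [FdH HB _] := dvd i.
have [spanW ow] := onW k.
(* The basis is square-integrable because its span is that of the dH i, which
   lie in F. *)
have FW j : F (W (u k.+1) (u k) j).
  apply: (lin_span_sub spF (f := fun i => dH i (u k.+1) (u k))).
    by move=> l; have [FdHl _ _] := dvd l; exact: FdHl.
  by rewrite -spanW; exact: mem_lin_span.
apply/eqP; rewrite -subr_eq0 HB//; apply/eqP.
have -> : u k.+1 - u k
    = projector Omega (W (u k.+1) (u k)) (psi h (u k) - u k).
  by rewrite {1}uS addrC addKr.
apply: (inner_lin_span_projector mOmega spF) => //.
  by apply: (function_spaceB spF) => //; exact: Fpsi.
by rewrite spanW; exact: (mem_lin_span (fun i => dH i (u k.+1) (u k))).
Qed.
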